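(* Let $n\geq 2$, let $I\subseteq\mathbb{R}$ be an open interval, let $\mathbf{r}:I\to\mathbb{R}^{n+1}\setminus\{0\}$ be a non-colliding curve, and let $C$ be an $n$-dimensional cone in $\mathbb{R}^{n+1}$. Then $\mathbf{r}$ is a geodesic on $C$ if and only if there exists a $2$-dimensional cone $D$ in $\mathbb{R}^{n+1}$ with $D\subseteq C$, of the same aperture as $C$, such that $\mathbf{r}$ is a geodesic on $D$.
   Context: All cones have their vertex at the origin. Colliding: a curve $\mathbf{r}:I\to\mathbb{R}^m\setminus\{0\}$ is colliding if $\dot{\mathbf{r}}(t)$ is parallel to $\mathbf{r}(t)$ (a scalar multiple of it, possibly zero) for every $t\in I$; otherwise it is non-colliding. $k$-dimensional cone in $\mathbb{R}^m$ ($k<m$): let $P$ be an affine $k$-dimensional plane in $\mathbb{R}^m$ that intersects the unit sphere $S^{m-1}$ in more than one point. The cone generated by $P$ is the set of all $\mathbf{x}\in\mathbb{R}^m\setminus\{0\}$ such that $\mathbf{x}/|\mathbf{x}|\in P$. A $k$-dimensional cone in $\mathbb{R}^m$ is any such set. Aperture: write $P=\mathbf{a}+U$ with $U$ a $k$-dimensional linear subspace and $\mathbf{a}\in U^\perp$ (then $\mathbf{a}$ is unique and $0\le|\mathbf{a}|<1$). The aperture of the cone generated by $P$ is the number $\psi\in(0,\pi/2]$ with $\cos\psi=|\mathbf{a}|$. (For $k=m-1$ this is consistent with the classical description of a cone directed along a nonzero $\mathbf{L}$ as $\{\mathbf{x}\neq0:\mathbf{x}\cdot\mathbf{L}=|\mathbf{x}||\mathbf{L}|\cos\psi\}$.)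 Geodesic: a geodesic on a cone $C$ in $\mathbb{R}^m$ is a differentiable map $\mathbf{r}:I\to\mathbb{R}^m\setminus\{0\}$ with $\mathbf{r}(I)\subseteq C$ and $\frac{D}{dt}\dot{\mathbf{r}}(t)=0$ for all $t\in I$, where $\frac{D}{dt}$ is the covariant derivative of the metric on $C$ inherited from the ambient Euclidean space (equivalently, the component of $\ddot{\mathbf{r}}$ tangent to $C$ vanishes). It need not be parametrized by arclength and can have any constant speed. *)

(* Defs.v *)
From HB Require Import structures.
From mathcomp Require Export all_boot all_order all_algebra.
From mathcomp Require Export all_classical all_reals all_analysis.

Set Implicit Arguments.
Unset Strict Implicit.
Unset Printing Implicit Defensive.

Export Order.TTheory GRing.Theory Num.Theory numFieldNormedType.Exports.

Local Open Scope classical_set_scope.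
Local Open Scope ring_scope.

Definition dot (R : realType) (m : nat) (u v : 'rV[R]_m) : R :=
  \sum_(i < m) u ord0 i * v ord0 i.

(* The Euclidean norm; the library norm [`|u|] on row vectors is the sup norm.
   The two induce the same topology, hence the same derivatives. *)
Definition enorm (R : realType) (m : nat) (u : 'rV[R]_m) : R :=
  Num.sqrt (dot u u).

Definition affine_plane (R : realType) (m : nat)
    (a : 'rV[R]_m) (U : {vspace 'rV[R]_m}) : set 'rV[R]_m :=
  [set x | x - a \in U].

Definition cone_generated (R : realType) (m : nat) (P : set 'rV[R]_m) :
    set 'rV[R]_m :=
  [set x | x != 0 /\ P ((enorm x)^-1 *: x)].

Definition cone_from (R : realType) (m k : nat) (C : set 'rV[R]_m)
    (a : 'rV[R]_m) (U : {vspace 'rV[R]_m}) : Prop :=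
  [/\ (k < m)%N,
      \dim U = k,
      exists x y : 'rV[R]_m,
        [/\ x <> y, enorm x = 1, enorm y = 1,
            affine_plane a U x & affine_plane a U y]
    & C = cone_generated (affine_plane a U)].

Definition is_cone (R : realType) (m k : nat) (C : set 'rV[R]_m) : Prop :=
  exists (a : 'rV[R]_m) (U : {vspace 'rV[R]_m}), cone_from k C a U.

Definition has_aperture (R : realType) (m k : nat) (C : set 'rV[R]_m)
    (psi : R) : Prop :=
  exists (a : 'rV[R]_m) (U : {vspace 'rV[R]_m}),
    [/\ cone_from k C a U,
        forall u, u \in U -> dot a u = 0,
        0 < psi <= pi / 2
      & cos psi = enorm a].

(* Curves on an open interval [I] are total functions of which only the values
   on [I] matter; derivatives at points of the open set [I] only depend on
   these values. *)
Definition open_interval (R : realType) (I : set R) : Prop :=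
  open I /\ is_interval I.

Definition curve (R : realType) (m : nat) (I : set R) (r : R -> 'rV[R]_m) :
    Prop :=
  forall t, I t -> derivable r t 1 /\ r t != 0.

Definition colliding (R : realType) (m : nat) (I : set R)
    (r : R -> 'rV[R]_m) : Prop :=
  forall t, I t -> exists c : R, derive1 r t = c *: r t.

(* Velocities at [x] of differentiable curves lying in [C]; for a submanifold
   [C] of R^m this is the tangent space at [x]. *)
Definition tangent (R : realType) (m : nat) (C : set 'rV[R]_m)
    (x : 'rV[R]_m) : set 'rV[R]_m :=
  [set v | exists (g : R -> 'rV[R]_m) (e : R),
     [/\ 0 < e,
         forall s, `|s| < e -> derivable g s 1 /\ C (g s),
         g 0 = x
       & derive1 g 0 = v]].

(* [w] is the covariant derivative at [t] of the vector field [V] along [r],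
   for the metric on [C] induced by the Euclidean one: [w] is the orthogonal
   projection of the ambient derivative of [V] on the tangent space of [C]. *)
Definition is_covariant_derivative (R : realType) (m : nat)
    (C : set 'rV[R]_m) (r V : R -> 'rV[R]_m) (t : R) (w : 'rV[R]_m) : Prop :=
  [/\ derivable V t 1,
      tangent C (r t) w
    & forall v, tangent C (r t) v -> dot (derive1 V t - w) v = 0].

Definition geodesic (R : realType) (m : nat) (I : set R) (C : set 'rV[R]_m)
    (r : R -> 'rV[R]_m) : Prop :=
  curve I r /\
  forall t, I t ->
    C (r t) /\ is_covariant_derivative C r (derive1 r) t 0.

(* Main.v *)
Require Import Defs.
From mathcomp Require Import ring lra.

Set Implicit Arguments.
Unset Strict Implicit.
Unset Printing Implicit Defensive.

Local Open Scope classical_set_scope.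
Local Open Scope ring_scope.

(** Write the plane generating a cone as [a + U] with [a] orthogonal to the
    linear subspace [U]; then [dot a a < 1], and [x] lies on the cone exactly
    when [x] is nonzero and its shadow [x - enorm x *: a] lies in [U].
    Everything is read off on shadows.  A vector [v] is tangent to the cone at
    [x] iff [v - (dot x v / enorm x) *: a] lies in [U] ([tangent_coneE]); in
    particular every [w] of [U] orthogonal to [x] is tangent.

    A geodesic [r] therefore has an acceleration orthogonal to every [w] of [U]
    that is orthogonal to [r]: its shadow undergoes a central motion in [U].
    Hence the angular momentum of the shadow, a 2-form on [U], is conserved
    ([wedge_conserved]).  At a time when the motion is not radial this form is
    nonzero, and its support is the plane [W] spanned by the shadows [p] and [q]
    of position and velocity.  A decomposable form determines its support, so
    the shadow stays in [W] for all times ([mem_span_wedge]), that is, [r]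
    stays on the 2-dimensional cone generated by [a + W].  This subcone has the
    same offset [a], hence the same aperture, and its tangent vectors are
    tangent to the large cone, so [r] is a geodesic on it
    ([geodesic_in_dim2_subcone]).

    Conversely, a subcone with the same aperture, generated by [b + W] with
    [b] orthogonal to [W], must satisfy [b = a] and [W <= U]
    ([subcone_same_offset]).  A vector tangent to the large cone at a point of
    the small one is the sum of a vector tangent to the small cone and of some
    [w] in [U] orthogonal to [W].  The curve stays orthogonal to [w], hence so
    does its acceleration, and a geodesic of the small cone is a geodesic of the
    large one ([geodesic_supercone]). *)

(** * Euclidean geometry of row vectors *)

Lemma dotC (R : realType) (m : nat) (u v : 'rV[R]_m) : dot u v = dot v u.
Proof. by apply: eq_bigr => i _; rewrite mulrC. Qed.

Lemma dotDl (R : realType) (m : nat) (u v w : 'rV[R]_m) :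
  dot (u + v) w = dot u w + dot v w.
Proof. by rewrite -big_split; apply: eq_bigr => i _; rewrite mxE mulrDl. Qed.

Lemma dotZl (R : realType) (m : nat) (c : R) (u w : 'rV[R]_m) :
  dot (c *: u) w = c * dot u w.
Proof. by rewrite mulr_sumr; apply: eq_bigr => i _; rewrite mxE mulrA. Qed.

Lemma dotNl (R : realType) (m : nat) (u w : 'rV[R]_m) :
  dot (- u) w = - dot u w.
Proof. by rewrite -scaleN1r dotZl mulN1r. Qed.

Lemma dotDr (R : realType) (m : nat) (u v w : 'rV[R]_m) :
  dot w (u + v) = dot w u + dot w v.
Proof. by rewrite dotC dotDl ![dot _ w]dotC. Qed.

Lemma dotZr (R : realType) (m : nat) (c : R) (u w : 'rV[R]_m) :
  dot w (c *: u) = c * dot w u.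
Proof. by rewrite dotC dotZl dotC. Qed.

Lemma dotNr (R : realType) (m : nat) (u w : 'rV[R]_m) :
  dot w (- u) = - dot w u.
Proof. by rewrite dotC dotNl dotC. Qed.

Lemma dot0l (R : realType) (m : nat) (w : 'rV[R]_m) : dot 0 w = 0.
Proof. by rewrite -(scale0r 0) dotZl mul0r. Qed.

Lemma dot0r (R : realType) (m : nat) (w : 'rV[R]_m) : dot w 0 = 0.
Proof. by rewrite dotC dot0l. Qed.

Definition dotE := (dotDl, dotDr, dotNl, dotNr, dotZl, dotZr, dot0l, dot0r).

Lemma dot_ge0 (R : realType) (m : nat) (u : 'rV[R]_m) : 0 <= dot u u.
Proof. by apply: sumr_ge0 => i _; rewrite -expr2 sqr_ge0. Qed.

Lemma dot_eq0 (R : realType) (m : nat) (u : 'rV[R]_m) :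
  (dot u u == 0) = (u == 0).
Proof.
apply/eqP/eqP => [h|->]; last by rewrite dot0l.
apply/rowP => i; rewrite mxE; apply/eqP.
rewrite -sqrf_eq0 expr2; apply/eqP.
by apply: (psumr_eq0P _ h) => // j _; rewrite -expr2 sqr_ge0.
Qed.

Lemma dot_gt0 (R : realType) (m : nat) (u : 'rV[R]_m) :
  (0 < dot u u) = (u != 0).
Proof. by rewrite lt_neqAle dot_ge0 andbT eq_sym dot_eq0. Qed.

Lemma enorm_ge0 (R : realType) (m : nat) (u : 'rV[R]_m) : 0 <= enorm u.
Proof. exact: sqrtr_ge0. Qed.

Lemma enorm_sqr (R : realType) (m : nat) (u : 'rV[R]_m) :
  enorm u ^+ 2 = dot u u.
Proof. by rewrite sqr_sqrtr// dot_ge0. Qed.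

Lemma enorm_gt0 (R : realType) (m : nat) (u : 'rV[R]_m) :
  (0 < enorm u) = (u != 0).
Proof. by rewrite sqrtr_gt0 dot_gt0. Qed.

Lemma enormZ (R : realType) (m : nat) (c : R) (u : 'rV[R]_m) :
  enorm (c *: u) = `|c| * enorm u.
Proof.
by rewrite /enorm !dotE mulrA -expr2 sqrtrM ?sqr_ge0// sqrtr_sqr.
Qed.

(** Gram-Schmidt: the projection on the span of [b :: X] adds to the projection
    on [X] a multiple of the part [b'] of [b] orthogonal to [X]. *)
Lemma orthogonal_projection_exists (R : realType) (m : nat)
    (U : {vspace 'rV[R]_m}) (x : 'rV[R]_m) :
  exists2 u, u \in U & forall v, v \in U -> dot (x - u) v = 0.
Proof.
rewrite -(span_basis (vbasisP U)); move: (tval (vbasis U)) => X {U}.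
elim: X x => [|b X ih] x.
  exists 0; first by rewrite mem0v.
  by move=> v; rewrite span_nil memv0 => /eqP ->; rewrite dot0r.
have [pb pbs pbo] := ih b; have [px pxs pxo] := ih x.
set b' := b - pb in pbo.
have sub v : v \in <<X>>%VS -> v \in <<b :: X>>%VS.
  by rewrite span_cons => vs; apply: (subvP (addvSr _ _)).
(* If [b' = 0], the coefficient is multiplied by the zero vector. *)
exists (px + (dot x b' / dot b' b') *: b').
  have bX : b \in <<b :: X>>%VS.
    by rewrite span_cons (subvP (addvSl _ _)) ?memv_line.
  by rewrite rpredD ?rpredZ ?rpredB// sub.
move=> v; rewrite span_cons => /memv_addP[_ /vlineP[k ->]] [w ws ->].
have -> : k *: b + w = k *: b' + (k *: pb + w).
  by rewrite addrA -scalerDr subrK.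
have ws' : k *: pb + w \in <<X>>%VS by rewrite rpredD ?rpredZ.
have := pxo _ ws'; have := pbo _ ws'; have := pbo _ pxs.
move: (k *: pb + w) b' {ws ws' pbo} => z c.
rewrite !(dotE, opprD) => cpx cz /eqP; rewrite subr_eq0 => /eqP ->.
rewrite cz (dotC px c) cpx.
have [->|c0] := eqVneq c 0; first by rewrite !dotE; ring.
by field; rewrite dot_eq0.
Qed.

(** * Derivatives of vector-valued curves *)

Lemma is_derive_rowP (R : realType) (m : nat) (f : R -> 'rV[R]_m) (t : R)
    (df : 'rV[R]_m) :
  is_derive t 1 f df <->
  forall i, is_derive t 1 (fun s => f s ord0 i) (df ord0 i).
Proof.
split=> [[ft <-] i|h].
  split; first by move/derivable_mxP : ft; apply.
  by rewrite derive_mx// mxE.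
have ft : derivable f t 1.
  by apply/derivable_mxP => i j; rewrite ord1; case: (h j).
split=> //; rewrite derive_mx//; apply/rowP => i; rewrite mxE.
by case: (h i).
Qed.

Lemma is_derive_dot (R : realType) (m : nat) (f g : R -> 'rV[R]_m) (t : R)
    (df dg : 'rV[R]_m) :
  is_derive t 1 f df -> is_derive t 1 g dg ->
  is_derive t 1 (fun s => dot (f s) (g s)) (dot df (g t) + dot (f t) dg).
Proof.
move=> /is_derive_rowP hf /is_derive_rowP hg.
have -> : (fun s => dot (f s) (g s)) =
    \sum_(i < m) ((fun s => f s ord0 i) * (fun s => g s ord0 i)).
  by apply/funext => s; rewrite fct_sumE.
rewrite -big_split; apply: is_derive_sum => i.
apply: (is_derive_eq (is_deriveM (hf i) (hg i))).
by rewrite addrC; congr (_ + _); rewrite [LHS]mulrC.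
Qed.

Lemma is_derive_dotr (R : realType) (m : nat) (f : R -> 'rV[R]_m) (t : R)
    (df u : 'rV[R]_m) :
  is_derive t 1 f df -> is_derive t 1 (fun s => dot (f s) u) (dot df u).
Proof.
move=> hf; apply: is_derive_eq.
  exact: is_derive_dot (is_derive_cst u t 1).
by rewrite dot0r addr0.
Qed.

Lemma is_derive_enorm (R : realType) (m : nat) (f : R -> 'rV[R]_m) (t : R)
    (df : 'rV[R]_m) :
  f t != 0 -> is_derive t 1 f df ->
  is_derive t 1 (fun s => enorm (f s)) (dot (f t) df / enorm (f t)).
Proof.
move=> ft0 hf; have nf : enorm (f t) != 0 by rewrite gt_eqF ?enorm_gt0.
apply: is_derive_eq.
  apply: is_derive1_comp; first by apply: is_derive1_sqrt; rewrite dot_gt0.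
  exact: is_derive_dot.
by rewrite (dotC df) -/(enorm (f t)); field.
Qed.

Lemma is_derive_scalev (R : realType) (m : nat) (f : R -> R) (t d : R)
    (u : 'rV[R]_m) :
  is_derive t 1 f d -> is_derive t 1 (fun s => f s *: u) (d *: u).
Proof.
move=> hf; apply/is_derive_rowP => i; rewrite mxE mulrC.
have -> : (fun s => (f s *: u) ord0 i) = u ord0 i \*: f.
  by apply/funext => s; rewrite mxE mulrC.
exact: is_deriveZ.
Qed.

(** The part of [df] orthogonal to [U] is orthogonal to the curve, hence to its
    derivative [df], hence to itself. *)
Lemma is_derive_in_vspace (R : realType) (m : nat) (U : {vspace 'rV[R]_m})
    (f : R -> 'rV[R]_m) (t : R) (df : 'rV[R]_m) :
  is_derive t 1 f df -> (\forall s \near t, f s \in U) -> df \in U.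
Proof.
move=> hf fU; have [u uU uo] := orthogonal_projection_exists U df.
suff /eqP : dot (df - u) (df - u) = 0.
  by rewrite dot_eq0 subr_eq0 => /eqP ->.
rewrite {2}[df - u]addrC dotDr dotNr uo// oppr0 add0r dotC.
have h0 : is_derive t 1 (fun s => dot (f s) (df - u)) 0.
  apply: near_eq_is_derive (is_derive_cst 0 t 1).
  by near do rewrite dotC uo//.
by have [_ <-] := h0; have [_ <-] := is_derive_dotr (df - u) hf.
Unshelve. all: by end_near. Qed.

Lemma is_derive_open (R : realType) (I : set R) (f g : R -> R) (t d : R) :
  open I -> I t -> {in I, f =1 g} -> is_derive t 1 f d -> is_derive t 1 g d.
Proof.
move=> oI It fg; apply: near_eq_is_derive; near=> s; apply: fg.
by rewrite inE; near: s; exact: open_nbhs_nbhs.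
Unshelve. all: by end_near. Qed.

Lemma is_derive0_eq (R : realType) (I : set R) (f : R -> R) (s t : R) :
  is_interval I -> (forall x, I x -> is_derive x 1 f 0) -> I s -> I t ->
  f s = f t.
Proof.
move=> itv f0; wlog st : s t / s <= t => [h Is It|Is It].
  by have /orP[st|st] := le_total s t; [|symmetry]; exact: h.
have sub x : x \in `[s, t] -> I x by rewrite in_itv; exact: itv.
have [||c _] := @MVT_segment R f (cst 0) s t st.
- by move=> x xst; apply/f0/sub; exact: subset_itv_oo_cc xst.
- by apply: derivable_within_continuous => x /sub/f0[].
by rewrite mul0r => /eqP; rewrite subr_eq0 => /eqP.
Qed.

(** * Cones and their offsets *)

Lemma cone_generatedE (R : realType) (m : nat) (a : 'rV[R]_m)
    (U : {vspace 'rV[R]_m}) (x : 'rV[R]_m) :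
  cone_generated (affine_plane a U) x <-> x != 0 /\ x - enorm x *: a \in U.
Proof.
split=> -[x0 xU]; split=> //;
  have nx : enorm x != 0 by rewrite gt_eqF ?enorm_gt0.
  have -> : x - enorm x *: a = enorm x *: ((enorm x)^-1 *: x - a).
    by rewrite scalerBr scalerA divff// scale1r.
  exact: rpredZ.
rewrite /affine_plane/=.
have -> : (enorm x)^-1 *: x - a = (enorm x)^-1 *: (x - enorm x *: a).
  by rewrite scalerBr scalerA mulVf// scale1r.
exact: rpredZ.
Qed.

Definition orthogonal_to (R : realType) (m : nat) (a : 'rV[R]_m)
  (U : {vspace 'rV[R]_m}) : Prop := forall u, u \in U -> dot a u = 0.

(** A generating plane is given by an arbitrary base point; moving it to the
    foot of the perpendicular from the origin does not change the plane. *)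
Lemma cone_from_orthogonal (R : realType) (m k : nat) (C : set 'rV[R]_m)
    (a : 'rV[R]_m) (U : {vspace 'rV[R]_m}) :
  cone_from k C a U -> exists2 b, cone_from k C b U & orthogonal_to b U.
Proof.
have [u uU uo] := orthogonal_projection_exists U a.
have PE : affine_plane a U = affine_plane (a - u) U.
  rewrite /affine_plane; apply/seteqP; split=> x /= xU.
    by rewrite opprB addrCA addrC rpredD.
  by rewrite -(addrK u (x - a)) rpredB// -addrA (addrC _ u) -opprB.
move=> [km dU pts CE]; exists (a - u); last exact: uo.
by rewrite /cone_from -PE.
Qed.

(** A plane at distance at least 1 from the origin meets the unit sphere at most
    at the foot [a] of the perpendicular, by Pythagoras. *)
Lemma offset_lt1 (R : realType) (m k : nat) (C : set 'rV[R]_m)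
    (a : 'rV[R]_m) (U : {vspace 'rV[R]_m}) :
  cone_from k C a U -> orthogonal_to a U -> dot a a < 1.
Proof.
move=> [_ _ [x [y [xy x1 y1 xU yU]]] _] aU; rewrite ltNge; apply/negP => a1.
suff foot z : enorm z = 1 -> affine_plane a U z -> z = a.
  by apply: xy; rewrite (foot x)// (foot y).
move=> z1 zU; apply/eqP; rewrite -subr_eq0 -dot_eq0 eq_le dot_ge0 andbT.
have := enorm_sqr z; rewrite z1 expr1n -{1 2}[z](subrK a).
rewrite dotDl (dotDr (z - a) a a) (dotDr (z - a) a (z - a)).
rewrite (dotC (z - a) a) (aU (z - a) zU); lra.
Qed.

Lemma sin_aperture_gt0 (R : realType) (m : nat) (a : 'rV[R]_m) :
  dot a a < 1 -> 0 < Num.sqrt (1 - dot a a).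
Proof. by move=> a1; rewrite sqrtr_gt0 subr_gt0. Qed.

(** The cone is the graph of [u |-> (enorm u / sin psi) *: a] over [U] minus the
    origin, where [sin psi = Num.sqrt (1 - dot a a)] and [psi] is the
    aperture. *)
Lemma cone_lift (R : realType) (m : nat) (a : 'rV[R]_m)
    (U : {vspace 'rV[R]_m}) (u : 'rV[R]_m) :
  dot a a < 1 -> orthogonal_to a U -> u \in U -> u != 0 ->
  let x := u + (enorm u / Num.sqrt (1 - dot a a)) *: a in
  enorm x = enorm u / Num.sqrt (1 - dot a a) /\
  cone_generated (affine_plane a U) x.
Proof.
move=> a1 aU uU u0 x; have := sin_aperture_gt0 a1.
have := @sqr_sqrtr _ (1 - dot a a); rewrite subr_ge0 => /(_ (ltW a1)).
rewrite /x; move: (Num.sqrt _) => rho rho2 rho0 {x}.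
have u_gt0 : 0 < enorm u by rewrite enorm_gt0.
set x := u + _.
have nx : enorm x = enorm u / rho.
  apply/eqP; rewrite -(@eqrXn2 _ 2) ?enorm_ge0 ?divr_ge0 ?ltW//; apply/eqP.
  rewrite enorm_sqr /x !dotE (dotC u) aU// -enorm_sqr.
  have -> : dot a a = 1 - rho ^+ 2 by rewrite rho2; ring.
  by field; rewrite gt_eqF.
split=> //; apply/cone_generatedE; split; last by rewrite nx addrK.
by rewrite -enorm_gt0 nx divr_gt0.
Qed.

(** The shadow is orthogonal to [a]; this is the classical equation
    [x . L = |x| |L| cos psi] with [L = a] and [cos psi = |a|]. *)
Lemma dot_cone_axis (R : realType) (m : nat) (a : 'rV[R]_m)
    (U : {vspace 'rV[R]_m}) (x : 'rV[R]_m) :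
  orthogonal_to a U -> cone_generated (affine_plane a U) x ->
  dot x a = enorm x * dot a a.
Proof.
move=> aU /cone_generatedE[_ /aU]; rewrite !dotE (dotC a) => /eqP.
by rewrite subr_eq0 => /eqP.
Qed.

Lemma enorm_shadow (R : realType) (m : nat) (a : 'rV[R]_m)
    (U : {vspace 'rV[R]_m}) (x : 'rV[R]_m) :
  dot a a < 1 ->
  orthogonal_to a U -> cone_generated (affine_plane a U) x ->
  enorm (x - enorm x *: a) = Num.sqrt (1 - dot a a) * enorm x.
Proof.
move=> a1 aU xC; apply/eqP.
rewrite -(@eqrXn2 _ 2) ?mulr_ge0 ?enorm_ge0 ?sqrtr_ge0//; apply/eqP.
rewrite exprMn !enorm_sqr sqr_sqrtr ?subr_ge0 ?ltW// !dotE.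
by rewrite (dotC a x) (dot_cone_axis aU xC) -enorm_sqr; ring.
Qed.

(** * Tangent spaces of cones *)

(** Differentiating the shadow of [g], which stays in [U]. *)
Lemma velocity_cone (R : realType) (m : nat) (a : 'rV[R]_m)
    (U : {vspace 'rV[R]_m}) (g : R -> 'rV[R]_m) (t : R) (v : 'rV[R]_m) :
  is_derive t 1 g v ->
  (\forall s \near t, cone_generated (affine_plane a U) (g s)) ->
  v - (dot (g t) v / enorm (g t)) *: a \in U.
Proof.
move=> hg gC; have /cone_generatedE[gt0 _] := nbhs_singleton gC.
apply: (is_derive_in_vspace (f := fun s => g s - enorm (g s) *: a)).
  exact: is_deriveB hg (is_derive_scalev a (is_derive_enorm gt0 hg)).
by near do apply: (proj2 ((cone_generatedE _ _ _).1 _)).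
Unshelve. all: by end_near. Qed.

(** A vector satisfying the condition is realised by moving the shadow [y] of
    [x] along the straight line [y + s *: w] in [U] and lifting it to the cone;
    the homogeneous lift gives the right velocity because
    [dot y w = sin psi ^+ 2 * dot x v]. *)
Lemma tangent_coneE (R : realType) (m : nat) (a : 'rV[R]_m)
    (U : {vspace 'rV[R]_m}) (x v : 'rV[R]_m) :
  dot a a < 1 -> orthogonal_to a U ->
  cone_generated (affine_plane a U) x ->
  tangent (cone_generated (affine_plane a U)) x v <->
  v - (dot x v / enorm x) *: a \in U.
Proof.
move=> a1 aU xC; split.
  move=> [g [e [e0 gC <- <-]]]; apply: velocity_cone.
    rewrite derive1E; apply: DeriveDef => //.
    by apply: (gC 0 _).1; rewrite normr0.
  near=> s; apply: (gC s _).2; near: s.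
  have /cvgr0_norm_lt : id x @[x --> (0 : R)] --> (0 : R) by exact: cvg_id.
  exact.
set w : 'rV[R]_m := v - _ => wU.
have ny := enorm_shadow a1 aU xC; have xa := dot_cone_axis aU xC.
have [x0 yU] := (cone_generatedE _ _ _).1 xC.
have rho0 := sin_aperture_gt0 a1.
have rho2 : Num.sqrt (1 - dot a a) ^+ 2 = 1 - dot a a.
  by rewrite sqr_sqrtr// subr_ge0 ltW.
have nx0 : 0 < enorm x by rewrite enorm_gt0.
set y : 'rV[R]_m := x - enorm x *: a in ny yU *.
set rho : R := Num.sqrt _ in ny rho0 rho2 *.
have y0 : y != 0 by rewrite -enorm_gt0 ny mulr_gt0.
have hl (s : R) : is_derive s 1 (fun s : R => y + s *: w) w.
  apply: (is_derive_eq
    (is_deriveD (is_derive_cst y s 1) (is_derive_scalev w (is_derive_id s 1)))).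
  by rewrite add0r scale1r.
have lg (s : R) : y + s *: w != 0 ->
  is_derive s 1 (fun s : R => y + s *: w + (enorm (y + s *: w) / rho) *: a)
    (w + (dot (y + s *: w) w / enorm (y + s *: w) / rho) *: a).
  move=> ys; apply: is_deriveD => //; apply: is_derive_scalev.
  have -> : (fun s => enorm (y + s *: w) / rho) =
            rho^-1 \*: (fun s => enorm (y + s *: w)).
    by apply/funext => z; rewrite mulrC.
  by rewrite [_ / rho]mulrC; apply: is_deriveZ; exact: is_derive_enorm.
exists (fun s => y + s *: w + (enorm (y + s *: w) / rho) *: a).
(* For such [s] the line has not reached the origin: it keeps a positive
   component along [y]. *)
exists (dot y y / (`|dot y w| + 1)); split.
- by rewrite divr_gt0 ?dot_gt0// ltr_wpDl.
- move=> s; rewrite ltr_pdivlMr ?ltr_wpDl// => se.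
  have ys : y + s *: w != 0.
    apply: contraTneq se => ys; rewrite -leNgt.
    have : dot y (y + s *: w) = 0 by rewrite ys dot0r.
    rewrite dotDr dotZr => /eqP; rewrite addr_eq0 => /eqP ->.
    rewrite (le_trans (ler_norm _))// normrN normrM ler_wpM2l//.
    by rewrite lerDl.
  split; first by have [] := lg s ys.
  by apply: (cone_lift a1 aU _ ys).2; rewrite rpredD// rpredZ.
- by rewrite scale0r addr0 ny mulrAC divff ?gt_eqF// mul1r subrK.
- have := lg 0; rewrite scale0r addr0 => /(_ y0)[_].
  rewrite derive1E => ->; rewrite ny.
  have -> : dot y w = rho ^+ 2 * dot x v.
    rewrite rho2 /y dotDl dotNl dotZl aU// /w !dotE xa.
    by field; rewrite gt_eqF.
  rewrite (_ : _ / rho = dot x v / enorm x) ?subrK//.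
  by field; rewrite !gt_eqF.
Unshelve. all: by end_near. Qed.

Lemma cone_generatedS (R : realType) (m : nat) (a : 'rV[R]_m)
    (W U : {vspace 'rV[R]_m}) :
  (W <= U)%VS ->
  cone_generated (affine_plane a W) `<=` cone_generated (affine_plane a U).
Proof.
by move=> /subvP WU x /cone_generatedE[x0 /WU xU]; exact/cone_generatedE.
Qed.

(** The two points of the unit sphere required in the plane are the antipodal
    ones above the direction [p]. *)
Lemma cone_from_orthogonal_offset (R : realType) (m k : nat) (a p : 'rV[R]_m)
    (W : {vspace 'rV[R]_m}) :
  (k < m)%N -> \dim W = k -> p \in W -> p != 0 ->
  dot a a < 1 -> orthogonal_to a W ->
  cone_from k (cone_generated (affine_plane a W)) a W.
Proof.
move=> km dW pW p0 a1 aW.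
have rho0 := sin_aperture_gt0 a1.
have unit (c : R) : `|c| = Num.sqrt (1 - dot a a) / enorm p ->
    enorm (a + c *: p) = 1 /\ affine_plane a W (a + c *: p).
  move=> cE; split; last by rewrite /affine_plane/= addrC addKr rpredZ.
  apply/eqP; rewrite -(@eqrXn2 _ 2) ?enorm_ge0//; apply/eqP.
  rewrite enorm_sqr !dotE (dotC p a) (aW p pW) expr1n.
  have -> : c * (c * dot p p) = (`|c| * enorm p) ^+ 2.
    by rewrite exprMn enorm_sqr real_normK ?num_real// expr2 mulrA.
  rewrite cE divfK; last by rewrite gt_eqF ?enorm_gt0.
  by rewrite sqr_sqrtr ?subr_ge0 ?ltW//; ring.
set c := Num.sqrt _ / _ in unit.
have c0 : 0 < c by rewrite divr_gt0 ?enorm_gt0.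
have [x1 xW] := unit c (gtr0_norm c0).
have [y1 yW] : enorm (a + - c *: p) = 1 /\ affine_plane a W (a + - c *: p).
  by apply: unit; rewrite normrN gtr0_norm.
split=> //; exists (a + c *: p), (a + - c *: p); split=> // /addrI/eqP.
rewrite -subr_eq0 -scalerBl opprK scaler_eq0 (negbTE p0) orbF.
by rewrite gt_eqF ?addr_gt0.
Qed.

Lemma has_aperture_acos (R : realType) (m k : nat) (C : set 'rV[R]_m)
    (a : 'rV[R]_m) (U : {vspace 'rV[R]_m}) :
  cone_from k C a U -> orthogonal_to a U ->
  has_aperture k C (acos (enorm a)).
Proof.
move=> hC aU; have a1 := offset_lt1 hC aU.
have na : enorm a < 1 by rewrite -[ltRHS]sqrtr1 ltr_sqrt.
have na0 := enorm_ge0 a.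
have na1 : -1 <= enorm a <= 1 by rewrite (le_trans _ na0) ?ltW ?ltrN10.
exists a, U; split=> //; last by rewrite acosK// in_itv.
rewrite acos_gt0 ?na ?andbT; last by case/andP: na1.
rewrite -acos0 leNgt; apply/negP => lt.
have : cos (acos (enorm a)) < cos (acos 0).
  by rewrite ltr_cos// in_itv/= ?acos_ge0 ?acos_lepi//; apply/andP; lra.
by rewrite !acosK ?in_itv//=; [rewrite ltNge na0 | apply/andP; lra].
Qed.

(** The lifts of [w] and [- w] to the small cone are on the large one, where
    their shadows are [w] and [- w] plus the same multiple of [b - a]; so [w]
    and [b - a] lie in [U].  Then [dot a b = dot a a],
    and [a] and [b] having the same norm are equal. *)
Lemma subcone_same_offset (R : realType) (m : nat) (a b : 'rV[R]_m)
    (U W : {vspace 'rV[R]_m}) :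
  dot a a < 1 -> dot b b = dot a a -> orthogonal_to a U -> orthogonal_to b W ->
  cone_generated (affine_plane b W) `<=` cone_generated (affine_plane a U) ->
  W != 0%VS -> b = a /\ (W <= U)%VS.
Proof.
move=> a1 ba aU bW sub W0.
have b1 : dot b b < 1 by rewrite ba.
have hw w : w \in W -> w != 0 -> w \in U /\ b - a \in U.
  move=> wW w0.
  have half v : v \in W -> v != 0 ->
      v + (enorm v / Num.sqrt (1 - dot a a)) *: (b - a) \in U.
    move=> vW v0; have [nx /sub/cone_generatedE[_]] := cone_lift b1 bW vW v0.
    by rewrite nx ba scalerBr addrA.
  have := half w wW w0; have := half (- w); rewrite rpredN oppr_eq0.
  move=> /(_ wW w0); rewrite -scaleN1r enormZ normrN1 mul1r scaleN1r.
  have : enorm w / Num.sqrt (1 - dot a a) != 0.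
    by rewrite gt_eqF// divr_gt0 ?enorm_gt0 ?sin_aperture_gt0.
  move: (_ / _) => c c0 hm hp.
  have wU : w \in U.
    have := rpredB hp hm; rewrite opprD opprK addrACA subrr addr0.
    by rewrite -mulr2n -scaler_nat rpredZeq pnatr_eq0.
  split=> //; have := rpredB hp wU.
  by rewrite addrAC subrr add0r rpredZeq (negbTE c0).
split.
  have [|_ dU] := hw _ (memv_pick W); first by rewrite vpick0.
  apply/eqP; rewrite -subr_eq0 -dot_eq0; apply/eqP.
  by have := aU _ dU; rewrite !dotE (dotC b a) ba; lra.
apply/subvP => w wW; have [->|w0] := eqVneq w 0; first exact: mem0v.
by case: (hw w wW w0).
Qed.

(** The 2-vectors [y /\ z] and [p /\ q] of [U] are supposed to agree as forms.
    Contracting them with [u] in [U] gives the vector identity [vec].  The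
    choice [u = dot y z *: y - dot y y *: z] is orthogonal to [y], so [vec]
    expresses the Gram determinant [G] times [y] in terms of [p] and [q].  If
    [G] vanishes, [y] and [z] are dependent, the forms vanish, and [p] and [q]
    are dependent too. *)
Lemma mem_span_wedge (R : realType) (m : nat) (U : {vspace 'rV[R]_m})
    (p q y z : 'rV[R]_m) :
  p \in U -> q \in U -> y \in U -> z \in U ->
  p != 0 -> q \notin <[p]>%VS ->
  (forall u w, u \in U -> w \in U ->
    dot u y * dot w z - dot u z * dot w y =
    dot u p * dot w q - dot u q * dot w p) ->
  y \in <<[:: q; p]>>%VS.
Proof.
move=> pU qU yU zU p0 qp wedge.
have vec u : u \in U ->
    dot u y *: z - dot u z *: y = dot u p *: q - dot u q *: p.
  move=> uU; apply/eqP; rewrite -subr_eq0 -dot_eq0.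
  set d := _ - _; have dU : d \in U by rewrite !(rpredB, rpredZ).
  suff h w : w \in U -> dot w d = 0 by rewrite h.
  by move=> wU; have := wedge u w uU wU; rewrite /d !dotE; lra.
have [y0|y0] := eqVneq y 0; first by rewrite y0 mem0v.
have qpW u : dot u p *: q - dot u q *: p \in <<[:: q; p]>>%VS.
  by rewrite rpredB// rpredZ// memv_span ?inE ?eqxx ?orbT.
set G := dot y y * dot z z - dot y z ^+ 2.
have [G0|G0] := eqVneq G 0.
  have yz : dot y y *: z = dot y z *: y.
    apply/eqP; rewrite -subr_eq0 -dot_eq0 !dotE (dotC z y); apply/eqP.
    by have := congr1 ( *%R (dot y y)) G0; rewrite mulr0 /G => <-; ring.
  have vec0 u : u \in U -> dot u p *: q - dot u q *: p = 0.
    move=> uU; rewrite -vec//; apply/eqP.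
    suff : dot y y *: (dot u y *: z - dot u z *: y) == 0.
      by rewrite scaler_eq0 dot_eq0 (negbTE y0).
    have yzu : dot y y * dot u z = dot y z * dot u y by rewrite -!dotZr yz.
    by rewrite scalerBr !scalerA yzu mulrC -scalerA yz scalerA mulrC subrr.
  move/eqP: (vec0 p pU); rewrite subr_eq0 => /eqP pq.
  move: qp; rewrite (_ : q = (dot p q / dot p p) *: p) ?rpredZ ?memv_line//.
  by rewrite mulrC -scalerA -pq scalerA mulVf ?scale1r ?dot_eq0.
have := vec (dot y z *: y - dot y y *: z).
rewrite rpredB ?rpredZ// => /(_ isT).
rewrite (_ : dot _ y = 0); last by rewrite !dotE (dotC z y); ring.
rewrite (_ : dot _ z = - G); last by rewrite !dotE /G; ring.
rewrite scale0r add0r scaleNr opprK => hG.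
have := qpW (dot y z *: y - dot y y *: z).
by rewrite -hG rpredZeq (negbTE G0).
Qed.
(** * Geodesics as central motions *)

Lemma geodesic_is_derive (R : realType) (m : nat) (I : set R)
    (C : set 'rV[R]_m) (r : R -> 'rV[R]_m) (t : R) :
  geodesic I C r -> I t ->
  is_derive t 1 r (derive1 r t) /\
  is_derive t 1 (derive1 r) (derive1 (derive1 r) t).
Proof.
by move=> [hr hg] It; rewrite !derive1E; split; split=> //;
  [case: (hr t It) | case: (hg t It) => _ []].
Qed.

Lemma geodesic_normal (R : realType) (m : nat) (I : set R)
    (C : set 'rV[R]_m) (r : R -> 'rV[R]_m) (t : R) (v : 'rV[R]_m) :
  geodesic I C r -> I t -> tangent C (r t) v ->
  dot (derive1 (derive1 r) t) v = 0.
Proof.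
by move=> [_ hg] It; have [_ [_ _ h]] := hg t It => /h; rewrite subr0.
Qed.

(** The covariant derivative prescribed for a geodesic is the zero vector, which
    is always tangent to a cone. *)
Lemma geodesicP (R : realType) (m : nat) (I : set R) (a : 'rV[R]_m)
    (U : {vspace 'rV[R]_m}) (r : R -> 'rV[R]_m) :
  dot a a < 1 -> orthogonal_to a U -> curve I r ->
  (forall t, I t -> [/\ cone_generated (affine_plane a U) (r t),
     derivable (derive1 r) t 1 &
     forall v, tangent (cone_generated (affine_plane a U)) (r t) v ->
       dot (derive1 (derive1 r) t) v = 0]) ->
  geodesic I (cone_generated (affine_plane a U)) r.
Proof.
move=> a1 aU hr h; split=> // t It; have [rC r2 rn] := h t It.
split=> //; split=> // [|v /rn]; last by rewrite subr0.
by apply/tangent_coneE => //; rewrite dot0r mul0r scale0r subr0 mem0v.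
Qed.

(** Conservation of angular momentum.  The derivative of the left-hand side is
    the product of the acceleration with [dot u r *: w - dot w r *: u], a vector
    of [U] orthogonal to [r] and thus tangent to the cone.  Since [u] and [w]
    are orthogonal to [a], the products see only the shadow of [r]. *)
Lemma wedge_conserved (R : realType) (m : nat) (I : set R) (a : 'rV[R]_m)
    (U : {vspace 'rV[R]_m}) (r : R -> 'rV[R]_m) (s t : R) (u w : 'rV[R]_m) :
  is_interval I -> dot a a < 1 -> orthogonal_to a U ->
  geodesic I (cone_generated (affine_plane a U)) r -> I s -> I t ->
  u \in U -> w \in U ->
  dot u (r s) * dot w (derive1 r s) - dot u (derive1 r s) * dot w (r s) =
  dot u (r t) * dot w (derive1 r t) - dot u (derive1 r t) * dot w (r t).
Proof.
move=> itv a1 aU hg Is It uU wU; rewrite !(dotC u) !(dotC w).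
pose F x := dot (r x) u * dot (derive1 r x) w -
            dot (derive1 r x) u * dot (r x) w.
apply: (is_derive0_eq (f := F) itv _ Is It) => x Ix.
have [hr1 hr2] := geodesic_is_derive hg Ix.
have xC := (hg.2 x Ix).1.
pose v := dot (r x) u *: w - dot (r x) w *: u.
have vn : dot (derive1 (derive1 r) x) v = 0.
  apply: (geodesic_normal hg Ix); apply/tangent_coneE => //.
  rewrite (_ : dot _ v = 0) ?mul0r ?scale0r ?subr0 ?rpredB ?rpredZ//.
  by rewrite /v !dotE; ring.
apply: (is_derive_eq (is_deriveB
  (is_deriveM (is_derive_dotr u hr1) (is_derive_dotr w hr2))
  (is_deriveM (is_derive_dotr u hr2) (is_derive_dotr w hr1)))).
rewrite -[RHS]vn /v !dotE /GRing.scale/=; ring.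
Qed.

(** If the shadow of the velocity is [c] times that of the position, homogeneity
    of the norm forces the same factor on the component along [a]. *)
Lemma velocity_radial (R : realType) (m : nat) (a : 'rV[R]_m)
    (U : {vspace 'rV[R]_m}) (x v : 'rV[R]_m) :
  dot a a < 1 -> orthogonal_to a U -> cone_generated (affine_plane a U) x ->
  v - (dot x v / enorm x) *: a \in <[x - enorm x *: a]>%VS ->
  exists c, v = c *: x.
Proof.
move=> a1 aU xC /vlineP[c hc]; exists c.
have [x0 _] := (cone_generatedE _ _ _).1 xC.
have nx : enorm x != 0 by rewrite gt_eqF ?enorm_gt0.
have xa := dot_cone_axis aU xC.
move: hc; set k := _ / _ => /eqP; rewrite subr_eq => /eqP hv.
suff kE : k = c * enorm x by rewrite hv kE scalerBr scalerA subrK.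
have kx : k * enorm x = dot x v by rewrite divfK.
have a1' : 1 - dot a a != 0 by rewrite gt_eqF ?subr_gt0.
apply: (mulIf nx); apply: (mulIf a1'); rewrite mulrBr mulr1.
by rewrite {1}kx hv !dotE xa -enorm_sqr; ring.
Qed.

(** * Comparison of a cone with its 2-dimensional subcones *)

(** The plane [W] is spanned by the shadows of position and velocity at a time
    when the velocity is not radial. *)
Lemma geodesic_in_dim2_subcone (R : realType) (m : nat) (I : set R) (a : 'rV[R]_m)
    (U : {vspace 'rV[R]_m}) (r : R -> 'rV[R]_m) :
  open I -> is_interval I -> dot a a < 1 -> orthogonal_to a U ->
  ~ colliding I r -> geodesic I (cone_generated (affine_plane a U)) r ->
  exists W : {vspace 'rV[R]_m},
    [/\ \dim W = 2, (W <= U)%VS &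
        geodesic I (cone_generated (affine_plane a W)) r].
Proof.
move=> oI itv a1 aU hnc hg.
have vel t : I t ->
    derive1 r t - (dot (r t) (derive1 r t) / enorm (r t)) *: a \in U.
  move=> It; have [hr1 _] := geodesic_is_derive hg It.
  apply: velocity_cone hr1 _; near=> s; apply: (hg.2 s _).1.
  by near: s; exact: open_nbhs_nbhs.
have [t0 It0 nr] : exists2 t, I t & ~ exists c, derive1 r t = c *: r t.
  by apply: contra_notP hnc => /forall2NP h t It; have [//|/contrapT] := h t.
have [rC0 _] := hg.2 t0 It0.
have [r0 pU] := (cone_generatedE _ _ _).1 rC0.
have qU := vel t0 It0.
have p0 : r t0 - enorm (r t0) *: a != 0.
  rewrite -enorm_gt0 (enorm_shadow a1 aU rC0).
  by rewrite mulr_gt0 ?sin_aperture_gt0 ?enorm_gt0.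
have qp : derive1 r t0 - (dot (r t0) (derive1 r t0) / enorm (r t0)) *: a
    \notin <[r t0 - enorm (r t0) *: a]>%VS.
  by apply/negP => /(velocity_radial a1 aU rC0).
set p : 'rV[R]_m := r t0 - _ in pU p0 qp; set q : 'rV[R]_m := _ - _ in qU qp.
have dW : \dim <<[:: q; p]>> = 2.
  have : free [:: q; p] by rewrite free_cons span_seq1 qp seq1_free.
  by move=> /eqP.
have WU : (<<[:: q; p]>> <= U)%VS.
  by apply/span_subvP => u; rewrite !inE => /orP[] /eqP ->.
have aW : orthogonal_to a <<[:: q; p]>>%VS by move=> u /(subvP WU)/aU.
have shadow u x k : u \in U -> dot u (x - k *: a) = dot u x.
  by move=> uU; rewrite !dotE (dotC u a) aU//; ring.
exists <<[:: q; p]>>%VS; split=> //; apply: geodesicP hg.1 _ => // t It.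
have [rC [r2 _ _]] := hg.2 t It; have [rt0 yU] := (cone_generatedE _ _ _).1 rC.
split=> //.
  apply/cone_generatedE; split=> //.
  apply: (mem_span_wedge pU qU yU (vel t It) p0 qp) => u w uU wU.
  by rewrite !shadow//; exact: wedge_conserved hg It It0 uU wU.
move=> v [g [e [e0 gW g0 dg]]]; apply: (geodesic_normal hg It).
by exists g, e; split=> // x /gW[gx /(cone_generatedS WU)].
Unshelve. all: by end_near. Qed.

(** [w2] below is the part orthogonal to [W] of the shadow of the tangent vector
    [v]; [v - w2] is tangent to the small cone because [w2] is orthogonal to the
    curve. *)
Lemma geodesic_supercone (R : realType) (m : nat) (I : set R) (a : 'rV[R]_m)
    (U W : {vspace 'rV[R]_m}) (r : R -> 'rV[R]_m) :
  open I -> dot a a < 1 -> orthogonal_to a U -> (W <= U)%VS ->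
  geodesic I (cone_generated (affine_plane a W)) r ->
  geodesic I (cone_generated (affine_plane a U)) r.
Proof.
move=> oI a1 aU WU hg.
have aW : orthogonal_to a W by move=> u /(subvP WU)/aU.
have DC := cone_generatedS (a := a) WU.
have perp w t : w \in U -> (forall u, u \in W -> dot w u = 0) -> I t ->
    dot (r t) w = 0.
  move=> wU wo It; have /cone_generatedE[_ /wo] := (hg.2 t It).1.
  by rewrite !dotE (dotC w a) aU// mulr0 subr0 dotC.
apply: geodesicP hg.1 _ => // t It; have [rD [r2 _ _]] := hg.2 t It.
split=> //; first exact: DC.
move=> v /(tangent_coneE _ a1 aU (DC _ rD)) vU.
have [w1 w1W w2o] := orthogonal_projection_exists W
  (v - (dot (r t) v / enorm (r t)) *: a).
set w2 : 'rV[R]_m := _ - _ in w2o.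
have w2U : w2 \in U by rewrite rpredB// (subvP WU).
have zero (f : R -> 'rV[R]_m) (x : R) df : is_derive x 1 f df -> I x ->
    (forall s, I s -> dot (f s) w2 = 0) -> dot df w2 = 0.
  move=> hf Ix f0.
  have [_ <-] := is_derive_dotr w2 hf.
  have [_ //] : is_derive x 1 (fun s => dot (f s) w2) 0.
  apply: (is_derive_open oI Ix _ (is_derive_cst 0 x 1)) => s.
  by rewrite inE => /f0.
have r0 s : I s -> dot (r s) w2 = 0 by exact: perp.
have r1 s : I s -> dot (derive1 r s) w2 = 0.
  by move=> Is; have [h _] := geodesic_is_derive hg Is; exact: zero h Is r0.
have r20 : dot (derive1 (derive1 r) t) w2 = 0.
  by have [_ h] := geodesic_is_derive hg It; exact: zero h It r1.
rewrite -[v](subrK w2) dotDr r20 addr0; apply: (geodesic_normal hg It).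
apply/tangent_coneE => //.
have -> : dot (r t) (v - w2) = dot (r t) v by rewrite dotDr dotNr r0// subr0.
by rewrite addrAC /w2 subKr.
Qed.

Theorem theorem6p1 (R : realType) (n : nat) (hn : (2 <= n)%N)
    (I : set R) (hI : open_interval I)
    (r : R -> 'rV[R]_n.+1) (hr : curve I r) (hnc : ~ colliding I r)
    (C : set 'rV[R]_n.+1) (hC : is_cone n C) :
  geodesic I C r <->
  exists D : set 'rV[R]_n.+1,
    [/\ is_cone 2 D,
        D `<=` C,
        exists psi : R, has_aperture n C psi /\ has_aperture 2 D psi
      & geodesic I D r].
Proof.
have [oI itv] := hI; split=> [hg|[D [_ DC [psi [apC apD]] hg]]].
  have [a0 [U /cone_from_orthogonal[a aC aU]]] := hC.
  have a1 := offset_lt1 aC aU; have [_ _ _ CE] := aC; rewrite CE in hg.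
  have [W [dW WU hgW]] := geodesic_in_dim2_subcone oI itv a1 aU hnc hg.
  have aW : orthogonal_to a W by move=> u /(subvP WU)/aU.
  have aD : cone_from 2 (cone_generated (affine_plane a W)) a W.
    apply: (cone_from_orthogonal_offset _ dW (memv_pick W)) => //.
    by rewrite vpick0 -dimv_eq0 dW.
  exists (cone_generated (affine_plane a W)); split=> //.
  - by exists a, W.
  - by rewrite CE; exact: cone_generatedS.
  - exists (acos (enorm a)).
    by split; [exact: has_aperture_acos aC aU | exact: has_aperture_acos aD aW].
have [a [U [aC aU _ apa]]] := apC; have [b [W [bD bW _ apb]]] := apD.
have a1 := offset_lt1 aC aU; have [_ _ _ CE] := aC; have [_ dW _ DE] := bD.
have ba : dot b b = dot a a by rewrite -!enorm_sqr -apa -apb.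
have W0 : W != 0%VS by rewrite -dimv_eq0 dW.
rewrite CE DE in DC hg *.
have [bE WU] := subcone_same_offset a1 ba aU bW DC W0.
by rewrite bE in hg; exact: geodesic_supercone WU hg.
Qed.
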